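(* Let $J$ be the Jacobi matrix of Example 4.1 (described in the context) and $\rho$ its spectral measure. Then for Lebesgue almost every $x_0\in[-2,2]\setminus[-1,1]$, $\rho$ fails the Nevai condition at $x_0$.
   Context: Example 4.1: partition $\{1,2,\dots\}$ into successive consecutive blocks $A_1,C_1,A_2,C_2,\dots$ (in this order) with $\#A_j=3^{j^2}$ and $\#C_j=2^{j^2}$. Let $J$ be the half-line Jacobi matrix on $\ell^2(\{1,2,\dots\})$ with $J_{nn}=b_n=0$, $J_{n,n+1}=J_{n+1,n}=a_n$, where $a_n=1$ for $n\in A_j$ and $a_n=\tfrac12$ for $n\in C_j$. Then $\sigma(J)=[-2,2]$ and $(a_1\cdots a_n)^{1/n}\to1$. Let $\rho$ be the spectral measure of $J$ and $\delta_1$, $p_n$ its orthonormal polynomials ($p_0=1$, so that $xp_n=a_{n+1}p_{n+1}+b_{n+1}p_n+a_np_{n-1}$, $p_{-1}=0$), $K_n(x,y)=\sum_{j=0}^np_j(x)p_j(y)$. The Nevai condition at $x_0$ means $K_n(x,x_0)^2\,d\rho(x)/K_n(x_0,x_0)\to\delta_{x_0}$ weakly as $n\to\infty$. *)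

(* Defs.v *)
From Stdlib Require Import Reals Lra Lia Arith List.
Open Scope R_scope.

(* offset j = #(A_1 ∪ C_1 ∪ ... ∪ A_j ∪ C_j) = sum_{i=1}^j (3^{i^2} + 2^{i^2}) *)
Fixpoint ex41_offset (j : nat) : nat :=
  match j with
  | O => O
  | S j' => (ex41_offset j' + (3 ^ (j * j) + 2 ^ (j * j)))%nat
  end.

(* n (>= 1) lies in A_j iff offset(j-1) < n <= offset(j-1) + 3^{j^2}.
   Since every block is nonempty, such a j satisfies 1 <= j <= n. *)
Definition ex41_inA (n : nat) : bool :=
  existsb (fun j => andb (Nat.ltb (ex41_offset (j - 1)) n)
                         (Nat.leb n (ex41_offset (j - 1) + 3 ^ (j * j))))
          (seq 1 n).

(* a_n for n >= 1 : 1 on the A-blocks, 1/2 on the C-blocks.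
   (a_0 is irrelevant: it only ever multiplies p_{-1} = 0 or v_0 = 0.) *)
Definition ex41_a (n : nat) : R := if ex41_inA n then 1 else / 2.

Definition ex41_b (n : nat) : R := 0.

(* Sequences v : nat -> R, index 0 unused (treated as v_0 = 0). *)
Definition jac_apply (v : nat -> R) (k : nat) : R :=
  match k with
  | O => 0
  | S k' => ex41_a k' * (match k' with O => 0 | _ => v k' end)
            + ex41_b k * v k + ex41_a k * v (S k)
  end.

Definition delta1 (k : nat) : R := if Nat.eqb k 1 then 1 else 0.

Fixpoint jac_pow_delta1 (n : nat) : nat -> R :=
  match n with
  | O => delta1
  | S n' => jac_apply (jac_pow_delta1 n')
  end.

Definition jac_moment (n : nat) : R := jac_pow_delta1 n 1%nat.

(* L f = \int f d rho for continuous f : R -> R.  A positive linear functional on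
   C(R) with the moments <delta_1, J^n delta_1>; such a functional is exactly
   integration against the (compactly supported, moment-determined) spectral
   measure of J and delta_1. *)
Definition is_spectral_integral (L : (R -> R) -> R) : Prop :=
  (forall f g : R -> R, continuity f -> continuity g ->
      L (fun x => f x + g x) = L f + L g) /\
  (forall (c : R) (f : R -> R), continuity f -> L (fun x => c * f x) = c * L f) /\
  (forall f : R -> R, continuity f -> (forall x, 0 <= f x) -> 0 <= L f) /\
  (forall n : nat, L (fun x => x ^ n) = jac_moment n).

(* ex41_pp n x = (p_{n-1}(x), p_n(x)), with p_{-1} = 0, p_0 = 1 and
   x p_n = a_{n+1} p_{n+1} + b_{n+1} p_n + a_n p_{n-1}. *)
Fixpoint ex41_pp (n : nat) (x : R) : R * R :=
  match n with
  | O => (0, 1)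
  | S n' => let (pm, pn) := ex41_pp n' x in
            (pn, ((x - ex41_b (S n')) * pn - ex41_a n' * pm) / ex41_a (S n'))
  end.

Definition ex41_p (n : nat) (x : R) : R := snd (ex41_pp n x).

Definition ex41_K (n : nat) (x y : R) : R :=
  sum_f_R0 (fun j => ex41_p j x * ex41_p j y) n.

(* K_n(x,x0)^2 d rho(x) / K_n(x0,x0) -> delta_{x0} weakly: for every bounded
   continuous f, \int f K_n(.,x0)^2 d rho / K_n(x0,x0) -> f(x0). *)
Definition nevai_at (L : (R -> R) -> R) (x0 : R) : Prop :=
  forall f : R -> R, continuity f -> (exists M, forall x, Rabs (f x) <= M) ->
    Un_cv (fun n => L (fun x => f x * (ex41_K n x x0) ^ 2) / ex41_K n x0 x0)
          (f x0).

Definition lebesgue_null (S : R -> Prop) : Prop :=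
  forall eps : R, 0 < eps ->
    exists a b : nat -> R,
      (forall k, a k <= b k) /\
      (forall x, S x -> exists k, a k < x < b k) /\
      (forall N, sum_f_R0 (fun k => b k - a k) N <= eps).

(* Main.v *)
Require Import Defs.
From Stdlib Require Import Reals Lra Lia Arith List.
From Stdlib Require Import Classical ClassicalEpsilon FunctionalExtensionality.
Open Scope R_scope.

(** Testing the Nevai condition at [x0] on a bounded function comparable to
    [(x - x0)^2] on the support of the measure gives, by the Christoffel-Darboux
    formula and orthonormality, [(p_n^2 + p_{n+1}^2) / K_n -> 0] at [x0].
    On the block [C_j], starting after index [s] and of length [2^{j^2}], the
    combination [g = p_{n+1} - mu p_n] is multiplied by [1 / mu > 1] at each step
    when [|x0| > 1], while [K_n] can only grow subexponentially; hence
    [g^2 <= d^2 K_s] at [n = s], with [d] exponentially small in [2^{j^2}].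
    By the confluent Christoffel-Darboux formula the angle
    [atan ((p_{s+1} / p_s - mu) / d)] increases with [x], at speed at least
    [1 / (2 d)] where [g^2 <= d^2 K_s].  It jumps only at the at most [s] zeros of
    [p_s], so its total increase is [O(s)] and the exceptional set has measure
    [O(s d)].  As [s = O(3^{j^2})], this tends to [0] with [j]. *)

(** * Finite sums and indicator values *)

Fixpoint rsum (f : nat -> R) (n : nat) : R :=
  match n with
  | O => 0
  | S m => rsum f m + f m
  end.

Lemma rsum_plus (f g : nat -> R) (n : nat) :
  rsum (fun i => f i + g i) n = rsum f n + rsum g n.
Proof. induction n as [|n IH]; simpl; lra. Qed.

Lemma rsum_scal (c : R) (f : nat -> R) (n : nat) :
  rsum (fun i => c * f i) n = c * rsum f n.
Proof. induction n as [|n IH]; simpl; lra. Qed.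

Lemma rsum_le (f g : nat -> R) (n : nat) :
  (forall i, f i <= g i) -> rsum f n <= rsum g n.
Proof.
  intros H; induction n as [|n IH]; simpl; [lra|].
  specialize (H n); lra.
Qed.

Lemma rsum_telescope (f : nat -> R) (n : nat) :
  rsum (fun i => f (S i) - f i) n = f n - f O.
Proof. induction n as [|n IH]; simpl; lra. Qed.

Definition ind (P : Prop) : R :=
  if excluded_middle_informative P then 1 else 0.

Lemma ind_true (P : Prop) : P -> ind P = 1.
Proof. unfold ind; destruct (excluded_middle_informative P); tauto. Qed.

Lemma ind_false (P : Prop) : ~ P -> ind P = 0.
Proof. unfold ind; destruct (excluded_middle_informative P); tauto. Qed.

Lemma ind_bounds (P : Prop) : 0 <= ind P <= 1.
Proof. unfold ind; destruct (excluded_middle_informative P); lra. Qed.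

(** * Polynomial functions *)

(** Horner form; coefficients may vanish, so [d] is only an upper bound for the degree. *)
Fixpoint polyfun (d : nat) (f : R -> R) : Prop :=
  match d with
  | O => exists c, forall x, f x = c
  | S d' => exists c g, polyfun d' g /\ forall x, f x = c + x * g x
  end.

Lemma polyfun_lin (d : nat) (u v : R) (f g : R -> R) :
  polyfun d f -> polyfun d g -> polyfun d (fun x => u * f x + v * g x).
Proof.
  revert f g; induction d as [|d IH]; simpl; intros f g.
  - intros [c Hc] [c' Hc']; exists (u * c + v * c'); intros x.
    rewrite Hc, Hc'; reflexivity.
  - intros (c & f' & Hf & Ef) (c' & g' & Hg & Eg).
    exists (u * c + v * c'), (fun x => u * f' x + v * g' x).
    split; [now apply IH|]; intros x; rewrite Ef, Eg; ring.
Qed.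

Lemma polyfun_weaken (d : nat) (f : R -> R) : polyfun d f -> polyfun (S d) f.
Proof.
  revert f; induction d as [|d IH]; intros f.
  - intros [c Hc]; exists c, (fun _ => 0); split; [now exists 0|].
    intros x; rewrite Hc; ring.
  - intros (c & g & Hg & E); exists c, g; split; [now apply IH|exact E].
Qed.

Lemma polyfun_mulx (d : nat) (f : R -> R) :
  polyfun d f -> polyfun (S d) (fun x => x * f x).
Proof. intros H; exists 0, f; split; [exact H|intros x; ring]. Qed.

Lemma polyfun_growth (d : nat) (f : R -> R) :
  polyfun d f -> exists C, 0 <= C /\
    forall x, 1 <= Rabs x -> Rabs (f x) <= C * Rabs x ^ d.
Proof.
  revert f; induction d as [|d IH]; intros f.
  - intros [c Hc]; exists (Rabs c); split; [apply Rabs_pos|].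
    intros x _; rewrite Hc; simpl; lra.
  - intros (c & g & Hg & E); destruct (IH g Hg) as (C & HC & B).
    exists (Rabs c + C); split; [pose proof (Rabs_pos c); lra|].
    intros x Hx; rewrite E.
    eapply Rle_trans; [apply Rabs_triang|]; rewrite Rabs_mult.
    specialize (B x Hx); pose proof (Rabs_pos c).
    assert (1 <= Rabs x ^ S d) by (apply pow_R1_Rle; exact Hx).
    simpl in *.
    assert (Rabs x * Rabs (g x) <= Rabs x * (C * Rabs x ^ d))
      by (apply Rmult_le_compat_l; lra).
    assert (Rabs c * 1 <= Rabs c * (Rabs x * Rabs x ^ d))
      by (apply Rmult_le_compat_l; lra).
    lra.
Qed.

(** Synthetic division: if the quotient of the Horner tail [g] by [x - r] is [g1], that of [f] is
    [g r + x * g1 x]. *)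
Lemma polyfun_factor (d : nat) (f : R -> R) (r : R) :
  polyfun (S d) f ->
  exists g, polyfun d g /\ forall x, f x = f r + (x - r) * g x.
Proof.
  revert f; induction d as [|d IH]; intros f (c & g & Hg & E).
  - destruct Hg as [k Hk]; exists (fun _ => k); split; [now exists k|].
    intros x; rewrite !E, !Hk; ring.
  - destruct (IH g Hg) as (g1 & H1 & E1).
    exists (fun x => g r + x * g1 x); split; [now exists (g r), g1|].
    intros x; rewrite (E x), (E r), (E1 x); ring.
Qed.

(** The cells are closed, so a grid point lies in two of them. The first two clauses, on the
    position of [r] relative to the last grid point, carry the induction. *)
Lemma grid_count_point (t : nat -> R) (r : R) (n : nat) :
  (forall i, t i < t (S i)) ->
  let c := rsum (fun i => ind (t i <= r <= t (S i))) n in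
  (t n < r -> c = 0) /\ (t n = r -> c <= 1) /\ c <= 2.
Proof.
  intros Ht; simpl; induction n as [|n (H1 & H2 & H3)]; simpl; [lra|].
  specialize (Ht n).
  destruct (Rtotal_order (t n) r) as [L|[L|L]].
  - specialize (H1 L); rewrite H1.
    pose proof (ind_bounds (t n <= r <= t (S n))).
    split; [|lra]; intros; rewrite ind_false; lra.
  - specialize (H2 L).
    pose proof (ind_bounds (t n <= r <= t (S n))); lra.
  - rewrite ind_false by lra; lra.
Qed.

(** Roots are divided out one at a time, and each accounts for at most two closed cells. *)
Lemma grid_count_roots (d : nat) (f : R -> R) (t : nat -> R) (n : nat) :
  (forall i, t i < t (S i)) -> polyfun d f -> (exists x, f x <> 0) ->
  rsum (fun i => ind (exists z, t i <= z <= t (S i) /\ f z = 0)) n <= 2 * INR d.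
Proof.
  intros Ht; revert f; induction d as [|d IH]; intros f Hf [x0 Hx0].
  - destruct Hf as [c Hc].
    (* Zero is written [0 * 0] so that [rsum_scal] evaluates the comparison sum. *)
    rewrite (Rle_antisym _ (rsum (fun _ => 0 * 0) n)).
    + rewrite rsum_scal; simpl; lra.
    + apply rsum_le; intros i; rewrite ind_false; [lra|].
      intros (z & _ & Hz); rewrite Hc in Hx0, Hz; lra.
    + apply rsum_le; intros i; pose proof (ind_bounds
        (exists z, t i <= z <= t (S i) /\ f z = 0)); lra.
  - destruct (excluded_middle_informative (exists r, f r = 0)) as [[r Hr]|N].
    + destruct (polyfun_factor d f r Hf) as (g & Hg & E).
      assert (Hg0 : exists x, g x <> 0).
      { exists x0; intros H; apply Hx0; rewrite E, H, Hr; ring. }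
      specialize (IH g Hg Hg0).
      pose proof (grid_count_point t r n Ht) as (_ & _ & H2).
      rewrite S_INR.
      apply Rle_trans with (rsum (fun i => ind (exists z, t i <= z <= t (S i) /\ g z = 0)
        + ind (t i <= r <= t (S i))) n); [|rewrite rsum_plus; lra].
      apply rsum_le; intros i.
      pose proof (ind_bounds (exists z, t i <= z <= t (S i) /\ g z = 0)).
      pose proof (ind_bounds (t i <= r <= t (S i))).
      unfold ind at 1; destruct excluded_middle_informative as [(z & Hz & Fz)|]; [|lra].
      destruct (Req_dec z r) as [->|Zr]; [rewrite (ind_true (_ <= r <= _)); lra|].
      rewrite ind_true; [lra|]; exists z; split; [exact Hz|].
      rewrite E, Hr in Fz; apply (Rmult_eq_reg_l (z - r)); lra.
    + apply Rle_trans with (rsum (fun _ => 0 * 0) n).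
      * apply rsum_le; intros i; rewrite ind_false; [lra|].
        intros (z & _ & Hz); apply N; now exists z.
      * rewrite rsum_scal; pose proof (pos_INR (S d)); lra.
Qed.

(** * Finite covers by intervals *)

Fixpoint total (l : list (R * R)) : R :=
  match l with
  | nil => 0
  | ab :: l' => (snd ab - fst ab) + total l'
  end.

Definition wf (l : list (R * R)) : Prop := forall ab, In ab l -> fst ab <= snd ab.

Definition covers (l : list (R * R)) (A : R -> Prop) : Prop :=
  forall x, A x -> exists ab, In ab l /\ fst ab < x < snd ab.

Lemma total_app (l m : list (R * R)) : total (l ++ m) = total l + total m.
Proof. induction l as [|ab l IH]; simpl; lra. Qed.

Lemma wf_app (l m : list (R * R)) : wf l -> wf m -> wf (l ++ m).
Proof. intros Hl Hm ab H; apply in_app_or in H; destruct H; auto. Qed.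

Lemma total_nonneg (l : list (R * R)) : wf l -> 0 <= total l.
Proof.
  induction l as [|ab l IH]; simpl; intros H; [lra|].
  assert (fst ab <= snd ab) by (apply H; now left).
  assert (0 <= total l) by (apply IH; intros cd Hcd; apply H; now right).
  lra.
Qed.

Lemma covers_reflect (l : list (R * R)) (A : R -> Prop) :
  wf l -> covers l A ->
  exists m, wf m /\ total m = total l /\ covers m (fun x => A (- x)).
Proof.
  intros Hw Hc; exists (map (fun ab => (- snd ab, - fst ab)) l); repeat split.
  - intros ab H; apply in_map_iff in H; destruct H as (cd & <- & Hcd).
    specialize (Hw cd Hcd); simpl; lra.
  - clear Hw Hc; induction l as [|ab l IH]; simpl; lra.
  - intros x Hx; destruct (Hc (- x) Hx) as (ab & Hab & Hi).
    exists (- snd ab, - fst ab); split; [|simpl; lra].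
    apply in_map_iff; now exists ab.
Qed.

(** [c i] is a budget for cell [i]. A cell meeting [A] is widened by [w] on both sides to an open
    interval of length [3 * w <= 3 * c i]; the other cells cost nothing. *)
Lemma covers_cells (A : R -> Prop) (t : nat -> R) (w : R) (c : nat -> R) (n : nat) :
  0 < w -> (forall i, t (S i) = t i + w) -> (forall i, (i < n)%nat -> 0 <= c i) ->
  (forall i, (i < n)%nat -> (exists x, A x /\ t i <= x <= t (S i)) -> w <= c i) ->
  exists l, wf l /\ total l <= 3 * rsum c n /\
    covers l (fun x => A x /\ t O <= x < t n).
Proof.
  intros Hw Ht; induction n as [|n IH]; intros Hc H.
  - exists nil; simpl; repeat split; [intros ab []|lra|].
    intros x [_ Hx]; lra.
  - destruct IH as (l & Wl & Tl & Cl); [auto|auto|].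
    destruct (excluded_middle_informative (exists x, A x /\ t n <= x <= t (S n))) as [Y|N].
    + exists ((t n - w, t n + 2 * w) :: l); repeat split.
      * intros ab [<-|Hab]; [simpl; lra|auto].
      * simpl; specialize (H n ltac:(lia) Y); lra.
      * intros x [Ax Hx]; rewrite Ht in Hx.
        destruct (Rlt_le_dec x (t n)) as [L|L].
        -- destruct (Cl x) as (ab & Hab & Hi); [split; [exact Ax|lra]|].
           exists ab; split; [now right|exact Hi].
        -- exists (t n - w, t n + 2 * w); split; [now left|simpl; lra].
    + exists l; repeat split; [exact Wl| |].
      * simpl; specialize (Hc n ltac:(lia)); lra.
      * intros x [Ax Hx]; apply Cl; split; [exact Ax|].
        split; [lra|]; apply Rnot_le_lt; intros L.
        apply N; exists x; split; [exact Ax|lra].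
Qed.

(** * Countable unions *)

(** Finite prefixes of the infinite concatenation of the lists; the [k]-th entry no longer changes
    once the prefix is longer than [k]. *)
Definition chain (ls : nat -> list (R * R)) (n : nat) : list (R * R) :=
  concat (map ls (seq 0 n)).

Lemma chain_S (ls : nat -> list (R * R)) (n : nat) :
  chain ls (S n) = chain ls n ++ ls n.
Proof.
  unfold chain; rewrite seq_S, map_app, concat_app; simpl.
  now rewrite app_nil_r.
Qed.

Lemma chain_length (ls : nat -> list (R * R)) (n : nat) :
  (forall i, ls i <> nil) -> (n <= length (chain ls n))%nat.
Proof.
  intros H; induction n as [|n IH]; [lia|].
  rewrite chain_S, length_app; specialize (H n).
  destruct (ls n); [congruence|simpl; lia].
Qed.

Lemma chain_nth (ls : nat -> list (R * R)) (d : R * R) (k m n : nat) :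
  (k < length (chain ls m))%nat -> (m <= n)%nat ->
  nth k (chain ls n) d = nth k (chain ls m) d.
Proof.
  intros Hk; induction 1 as [|n Hmn IH]; [reflexivity|].
  rewrite chain_S, app_nth1; [exact IH|].
  clear IH; induction Hmn; [exact Hk|].
  rewrite chain_S, length_app; lia.
Qed.

Lemma total_prefix (l : list (R * R)) (d : R * R) (n : nat) :
  wf l -> (n < length l)%nat ->
  sum_f_R0 (fun k => snd (nth k l d) - fst (nth k l d)) n <= total l.
Proof.
  revert n; induction l as [|ab l IH]; simpl; intros n Hw Hn; [lia|].
  assert (Wl : wf l) by (intros cd Hcd; apply Hw; now right).
  destruct n as [|n].
  - simpl; pose proof (total_nonneg l Wl); lra.
  - rewrite decomp_sum by lia; simpl.
    specialize (IH n Wl ltac:(lia)); simpl in IH; lra.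
Qed.

Lemma wf_chain (ls : nat -> list (R * R)) (n : nat) :
  (forall i, wf (ls i)) -> wf (chain ls n).
Proof.
  intros H; induction n as [|n IH]; [intros ab []|].
  rewrite chain_S; apply wf_app; auto.
Qed.

Lemma total_chain (ls : nat -> list (R * R)) (e : R) (n : nat) :
  (forall i, total (ls i) <= e * (/ 2) ^ S i) ->
  total (chain ls n) <= e * (1 - (/ 2) ^ n).
Proof.
  intros H; induction n as [|n IH]; [simpl; lra|].
  rewrite chain_S, total_app; specialize (H n); simpl in *; lra.
Qed.

(** The [i]-th set receives a cover of length at most [e / 2^(i+1)], and the concatenated covers are
    read off as a single sequence of intervals. *)
Lemma null_union (A : nat -> R -> Prop) :
  (forall i e, 0 < e -> exists l, wf l /\ total l <= e /\ covers l (A i)) ->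
  lebesgue_null (fun x => exists i, A i x).
Proof.
  intros H e He.
  assert (He' : forall i, 0 < e * (/ 2) ^ S i)
    by (intros i; apply Rmult_lt_0_compat; [exact He|apply pow_lt; lra]).
  assert (H' : forall i, exists l, wf l /\ total l <= e * (/ 2) ^ S i /\
                 covers l (A i) /\ l <> nil).
  { intros i; destruct (H i _ (He' i)) as (l & W & T & C).
    (* The degenerate interval adds no length and makes each list nonempty, so that [n] lists have
       at least [n] entries in all. *)
    exists ((0, 0) :: l); repeat split; [|simpl in *; lra| |discriminate].
    - intros ab [<-|Hab]; [simpl; lra|auto].
    - intros x Hx; destruct (C x Hx) as (ab & Hab & Hi).
      exists ab; split; [now right|exact Hi]. }
  destruct (choice _ H') as [ls Hls].
  assert (Hne : forall i, ls i <> nil) by apply Hls.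
  assert (Hwf : forall i, wf (ls i)) by apply Hls.
  assert (Len : forall n, (n <= length (chain ls n))%nat)
    by (intros n; now apply chain_length).
  set (s := fun k => nth k (chain ls (S k)) (0, 0)).
  exists (fun k => fst (s k)), (fun k => snd (s k)); repeat split.
  - intros k; apply (wf_chain ls (S k) Hwf), nth_In.
    specialize (Len (S k)); lia.
  - intros x [i Ax].
    destruct (Hls i) as (_ & _ & C & _); destruct (C x Ax) as (ab & Hab & Hi).
    assert (Hin : In ab (chain ls (S i)))
      by (rewrite chain_S; apply in_or_app; now right).
    destruct (In_nth _ _ (0, 0) Hin) as (k & Hk & E).
    exists k; replace (s k) with ab; [exact Hi|]; unfold s; rewrite <- E.
    destruct (Nat.le_ge_cases (S i) (S k)) as [L|L].
    + symmetry; now apply chain_nth.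
    + apply chain_nth; [specialize (Len (S k)); lia|exact L].
  - intros N; apply Rle_trans with (total (chain ls (S N))).
    + rewrite (sum_eq _ (fun k => snd (nth k (chain ls (S N)) (0, 0))
                                - fst (nth k (chain ls (S N)) (0, 0)))).
      * apply total_prefix; [now apply wf_chain|specialize (Len (S N)); lia].
      * intros k Hk; unfold s.
        rewrite <- (chain_nth ls (0, 0) k (S k) (S N)); [reflexivity| |lia].
        specialize (Len (S k)); lia.
    + eapply Rle_trans; [apply total_chain; intros i; apply Hls|].
      assert (0 < (/ 2) ^ S N) by (apply pow_lt; lra).
      rewrite Rmult_minus_distr_l; assert (0 < e * (/2) ^ S N) by now apply Rmult_lt_0_compat.
      lra.
Qed.

(** * The coefficients *)

Lemma a_cases (n : nat) : ex41_a n = 1 \/ ex41_a n = / 2.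
Proof. unfold ex41_a; destruct ex41_inA; auto. Qed.

Lemma a_bounds (n : nat) : / 2 <= ex41_a n <= 1.
Proof. destruct (a_cases n) as [-> | ->]; lra. Qed.

Lemma offset_S (j : nat) :
  ex41_offset (S j) = (ex41_offset j + (3 ^ (S j * S j) + 2 ^ (S j * S j)))%nat.
Proof. reflexivity. Qed.

Lemma offset_mono (i j : nat) : (i <= j)%nat -> (ex41_offset i <= ex41_offset j)%nat.
Proof. induction 1; [lia|rewrite offset_S; lia]. Qed.

Lemma offset_ge (j : nat) : (j <= ex41_offset j)%nat.
Proof.
  induction j as [|j IH]; [simpl; lia|]; rewrite offset_S.
  assert (3 ^ (S j * S j) <> 0)%nat by (apply Nat.pow_nonzero; lia); lia.
Qed.

(** The last [A]-block dominates everything before it: the constant 4 survives the induction because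
    [4 / 3 + 2 <= 4]. *)
Lemma offset_le (j : nat) : (ex41_offset j <= 4 * 3 ^ (j * j))%nat.
Proof.
  induction j as [|j IH]; [simpl; lia|]; rewrite offset_S.
  assert (2 ^ (S j * S j) <= 3 ^ (S j * S j))%nat by (apply Nat.pow_le_mono_l; lia).
  assert (3 ^ S (j * j) <= 3 ^ (S j * S j))%nat by (apply Nat.pow_le_mono_r; lia).
  rewrite Nat.pow_succ_r' in *; lia.
Qed.

(** Indices are shifted by one: [cstart j] is the last index before the block $C_{j+1}$, and
    [clen j] is the length of that block. *)
Definition cstart (j : nat) : nat := (ex41_offset j + 3 ^ (S j * S j))%nat.

Definition clen (j : nat) : nat := (2 ^ (S j * S j))%nat.

Lemma a_on_C (j n : nat) :
  (cstart j < n <= cstart j + clen j)%nat -> ex41_a n = / 2.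
Proof.
  unfold cstart, clen; intros Hn; unfold ex41_a.
  destruct (ex41_inA n) eqn:E; [exfalso|reflexivity].
  apply existsb_exists in E; destruct E as (i & Hi & E).
  apply in_seq in Hi; apply andb_prop in E; destruct E as [E1 E2].
  apply Nat.ltb_lt in E1; apply Nat.leb_le in E2.
  destruct i as [|i]; [lia|]; replace (S i - 1)%nat with i in * by lia.
  destruct (Nat.lt_trichotomy i j) as [L|[->|L]]; [|lia|].
  - pose proof (offset_mono (S i) j L) as M; rewrite offset_S in M; lia.
  - pose proof (offset_mono (S j) i L) as M; rewrite offset_S in M; lia.
Qed.

(** * Orthonormal polynomials *)

Lemma p_0 (x : R) : ex41_p 0 x = 1.
Proof. reflexivity. Qed.

Lemma p_1 (x : R) : x * ex41_p 0 x = ex41_a 1 * ex41_p 1 x.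
Proof.
  pose proof (a_bounds 1); unfold ex41_p, ex41_b; simpl; unfold ex41_b; field; lra.
Qed.

Lemma p_SS (n : nat) (x : R) :
  x * ex41_p (S n) x =
  ex41_a (S (S n)) * ex41_p (S (S n)) x + ex41_a (S n) * ex41_p n x.
Proof.
  pose proof (a_bounds (S (S n))).
  pose proof (a_bounds (S n)).
  unfold ex41_p; simpl; destruct (ex41_pp n x) as [u v]; simpl.
  unfold ex41_b; field; lra.
Qed.

Lemma p_SS_eq (n : nat) (x : R) :
  ex41_p (S (S n)) x =
  / ex41_a (S (S n)) * (x * ex41_p (S n) x) + - (ex41_a (S n) / ex41_a (S (S n))) * ex41_p n x.
Proof. pose proof (a_bounds (S (S n))); rewrite p_SS; field; lra. Qed.

Lemma p_1_eq (x : R) : ex41_p 1 x = / ex41_a 1 * x.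
Proof.
  pose proof (a_bounds 1); pose proof (p_1 x) as E; rewrite p_0 in E.
  apply (Rmult_eq_reg_l (ex41_a 1)); [|lra].
  rewrite <- E; field; lra.
Qed.

Lemma p_polyfun (n : nat) : polyfun n (ex41_p n).
Proof.
  enough (polyfun n (ex41_p n) /\ polyfun (S n) (ex41_p (S n))) by tauto.
  induction n as [|n [IH1 IH2]].
  - split; [now exists 1|].
    exists 0, (fun _ => / ex41_a 1); split; [now exists (/ ex41_a 1)|].
    intros x; rewrite p_1_eq; ring.
  - split; [exact IH2|].
    rewrite (functional_extensionality _ _ (p_SS_eq n)).
    apply polyfun_lin; [now apply polyfun_mulx|].
    now apply polyfun_weaken, polyfun_weaken.
Qed.

(** As the diagonal of the matrix vanishes, the recurrence preserves parity; this reduces negative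
    points to positive ones. *)
Lemma p_opp (n : nat) (x : R) : ex41_p n (- x) = (-1) ^ n * ex41_p n x.
Proof.
  enough (ex41_p n (- x) = (-1) ^ n * ex41_p n x /\
          ex41_p (S n) (- x) = (-1) ^ S n * ex41_p (S n) x) by tauto.
  induction n as [|n [IH1 IH2]].
  - rewrite !p_1_eq, !p_0; simpl; lra.
  - split; [exact IH2|]; rewrite !p_SS_eq, IH1, IH2; simpl; ring.
Qed.

Lemma K_S (n : nat) (x y : R) :
  ex41_K (S n) x y = ex41_K n x y + ex41_p (S n) x * ex41_p (S n) y.
Proof. reflexivity. Qed.

Lemma p_sq_opp (n : nat) (x : R) : ex41_p n (- x) ^ 2 = ex41_p n x ^ 2.
Proof.
  rewrite p_opp, Rpow_mult_distr, <- pow_mult, Nat.mul_comm, pow_mult.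
  replace ((-1) ^ 2) with 1 by ring; rewrite pow1; ring.
Qed.

Lemma K_opp (n : nat) (x : R) : ex41_K n (- x) (- x) = ex41_K n x x.
Proof.
  apply sum_eq; intros i _; pose proof (p_sq_opp i x); simpl in *; lra.
Qed.

Lemma K_ge_1 (n : nat) (x : R) : 1 <= ex41_K n x x.
Proof.
  induction n as [|n IH]; [unfold ex41_K; simpl; rewrite p_0; lra|].
  rewrite K_S; pose proof (Rle_0_sqr (ex41_p (S n) x)); unfold Rsqr in *; lra.
Qed.

Lemma K_ge_p (n : nat) (x : R) : ex41_p n x ^ 2 <= ex41_K n x x.
Proof.
  destruct n as [|n]; [unfold ex41_K; simpl; lra|].
  rewrite K_S; pose proof (K_ge_1 n x); simpl; lra.
Qed.

Lemma christoffel_darboux (n : nat) (x y : R) :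
  (x - y) * ex41_K n x y =
  ex41_a (S n) * (ex41_p (S n) x * ex41_p n y - ex41_p n x * ex41_p (S n) y).
Proof.
  induction n as [|n IH].
  - unfold ex41_K; simpl sum_f_R0.
    pose proof (p_1 x); pose proof (p_1 y); rewrite !p_0 in *; lra.
  - rewrite K_S, Rmult_plus_distr_l, IH.
    assert (E : (x - y) * (ex41_p (S n) x * ex41_p (S n) y) =
      (x * ex41_p (S n) x) * ex41_p (S n) y - ex41_p (S n) x * (y * ex41_p (S n) y)) by ring.
    rewrite E, !p_SS; ring.
Qed.

(** Proved by differentiating the recurrence, so that the same induction also provides the
    derivatives. The formula excludes common zeros of consecutive polynomials and drives the
    angle. *)
Lemma confluent_christoffel_darboux (n : nat) (x : R) :
  exists d0 d1, derivable_pt_lim (ex41_p n) x d0 /\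
    derivable_pt_lim (ex41_p (S n)) x d1 /\
    ex41_a (S n) * (d1 * ex41_p n x - d0 * ex41_p (S n) x) = ex41_K n x x.
Proof.
  induction n as [|n (d0 & d1 & H0 & H1 & E)].
  - pose proof (a_bounds 1).
    exists 0, (/ ex41_a 1); split; [apply derivable_pt_lim_const|split].
    + rewrite (functional_extensionality _ _ p_1_eq).
      replace (/ ex41_a 1) with (/ ex41_a 1 * 1) at 2 by ring.
      apply derivable_pt_lim_scal, derivable_pt_lim_id.
    + unfold ex41_K; simpl; rewrite !p_0; field; lra.
  - pose proof (a_bounds (S (S n))).
    exists d1, (/ ex41_a (S (S n)) * (1 * ex41_p (S n) x + x * d1)
                + - (ex41_a (S n) / ex41_a (S (S n))) * d0).
    split; [exact H1|split].
    + rewrite (functional_extensionality _ _ (p_SS_eq n)).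
      apply (derivable_pt_lim_plus
        (fun x => / ex41_a (S (S n)) * (x * ex41_p (S n) x))
        (fun x => - (ex41_a (S n) / ex41_a (S (S n))) * ex41_p n x)).
      * apply (derivable_pt_lim_scal (fun x => x * ex41_p (S n) x)).
        apply (derivable_pt_lim_mult (fun x => x)); [apply derivable_pt_lim_id|exact H1].
      * now apply derivable_pt_lim_scal.
    + rewrite K_S, <- E, p_SS_eq; field; lra.
Qed.

(** * Growth across a block where [a = 1/2] *)

(* [mu] and [1 / mu] are the two solutions of [t + 1 / t = 2 x]. *)
Definition mu (x : R) : R := x - sqrt (x * x - 1).

Lemma mu_pos (x : R) : 1 < x -> 0 < mu x.
Proof.
  intros Hx; unfold mu.
  assert (sqrt (x * x - 1) < sqrt (x * x)) by (apply sqrt_lt_1; nra).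
  rewrite sqrt_square in *; lra.
Qed.

Lemma mu_lt_1 (x : R) : 1 < x -> mu x < 1.
Proof.
  intros Hx; unfold mu.
  assert (x - 1 < sqrt (x * x - 1)); [|lra].
  rewrite <- (sqrt_square (x - 1)) by lra.
  apply sqrt_lt_1; nra.
Qed.

(** Only the sign matters later: since [mu] decreases, subtracting it can only speed up the
    angle. *)
Lemma mu_derivative (x : R) :
  1 < x -> exists m, derivable_pt_lim mu x m /\ m <= 0.
Proof.
  intros Hx; assert (P : 0 < x * x - 1) by nra.
  assert (S0 : 0 < sqrt (x * x - 1)) by now apply sqrt_lt_R0.
  exists (1 - / (2 * sqrt (x * x - 1)) * (1 * x + x * 1 - 0)); split.
  - apply (derivable_pt_lim_minus (fun x => x) (fun x => sqrt (x * x - 1))).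
    + apply derivable_pt_lim_id.
    + apply (derivable_pt_lim_comp (fun x => x * x - 1) sqrt).
      * apply (derivable_pt_lim_minus (fun x => x * x) (fun _ => 1)).
        -- apply (derivable_pt_lim_mult (fun x => x) (fun x => x));
             apply derivable_pt_lim_id.
        -- apply derivable_pt_lim_const.
      * now apply derivable_pt_lim_sqrt.
  - pose proof (mu_pos x Hx) as M; unfold mu in M.
    replace (/ (2 * sqrt (x * x - 1)) * (1 * x + x * 1 - 0))
      with (x / sqrt (x * x - 1)) by (field; lra).
    assert (1 <= x / sqrt (x * x - 1)); [|lra].
    apply (Rmult_le_reg_r (sqrt (x * x - 1))); [exact S0|].
    unfold Rdiv; rewrite Rmult_assoc, Rinv_l; lra.
Qed.

(** The factor [x - 1] in the hypothesis is chosen so that one step multiplies $K_n$ by at most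
    [x]. *)
Lemma K_growth (s : nat) (x : R) :
  1 <= x ->
  (forall n, (s <= n)%nat -> ex41_p n x ^ 2 + ex41_p (S n) x ^ 2 <= (x - 1) * ex41_K n x x) ->
  forall k, ex41_K (s + k) x x <= x ^ k * ex41_K s x x.
Proof.
  intros Hx H k; induction k as [|k IH].
  - rewrite Nat.add_0_r; simpl; lra.
  - rewrite Nat.add_succ_r, K_S; specialize (H (s + k)%nat ltac:(lia)).
    simpl in *.
    assert (x * ex41_K (s + k) x x <= x * (x ^ k * ex41_K s x x))
      by (apply Rmult_le_compat_l; lra).
    pose proof (Rle_0_sqr (ex41_p (s + k) x)); unfold Rsqr in *; lra.
Qed.

(** Along the block the square of the combination grows by at least $x^2$ per step, because
    [1 / mu x >= x], while $K_n$ grows by at most $x$. The surplus is the factor [x ^ l]. *)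
Lemma block_growth (s l : nat) (x : R) :
  1 < x <= 2 ->
  (forall n, (s < n <= s + S l)%nat -> ex41_a n = / 2) ->
  (forall n, (s <= n)%nat -> ex41_p n x ^ 2 + ex41_p (S n) x ^ 2 <= (x - 1) * ex41_K n x x) ->
  (ex41_p (S s) x - mu x * ex41_p s x) ^ 2 * x ^ l <= 2 * ex41_K s x x.
Proof.
  intros Hx Ha H.
  set (la := x + sqrt (x * x - 1)).
  assert (Sq : sqrt (x * x - 1) * sqrt (x * x - 1) = x * x - 1) by (apply sqrt_sqrt; nra).
  assert (S0 : 0 <= sqrt (x * x - 1)) by apply sqrt_pos.
  set (g := fun k => ex41_p (S (s + k)) x - mu x * ex41_p (s + k) x).
  (* Each step uses two consecutive coefficients equal to 1/2, so the [l + 1] coefficients of the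
     hypothesis give [l] steps. *)
  assert (G : forall k, (k <= l)%nat -> g k = la ^ k * g O).
  { intros k; induction k as [|k IH]; intros Hk; [simpl; ring|].
    simpl pow; rewrite Rmult_assoc, <- IH by lia.
    unfold g; rewrite Nat.add_succ_r, p_SS_eq, !Ha by lia.
    unfold la, mu; replace (/ / 2) with 2 by field.
    replace (- (/ 2 / / 2)) with (-1) by field.
    set (r := sqrt (x * x - 1)) in *.
    set (u := ex41_p (S (s + k)) x); set (v := ex41_p (s + k) x).
    transitivity ((x + r) * u - v); [ring|].
    (* This inserts [la * mu x = 1]. *)
    replace v with ((x * x - r * r) * v) at 1 by (rewrite Sq; ring); ring. }
  specialize (G l (le_n l)).
  pose proof (K_growth s x ltac:(lra) H l) as Kg.
  specialize (H (s + l)%nat ltac:(lia)).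
  pose proof (mu_pos x (proj1 Hx)); pose proof (mu_lt_1 x (proj1 Hx)).
  assert (B : g l ^ 2 <= 2 * x ^ l * ex41_K s x x).
  { pose proof (K_ge_1 (s + l) x).
    (* Here [(u - mu v)^2 <= 2 (u^2 + v^2)] since [mu < 1]; the passage to $K$ then uses
       [x - 1 <= 1]. *)
    apply Rle_trans with (2 * (ex41_p (s + l) x ^ 2 + ex41_p (S (s + l)) x ^ 2)); [|nra].
    unfold g; set (u := ex41_p (S (s + l)) x); set (v := ex41_p (s + l) x).
    pose proof (Rle_0_sqr (u + mu x * v)) as Q; unfold Rsqr in Q.
    assert (mu x * mu x <= 1) by nra.
    pose proof (Rle_0_sqr v) as V; unfold Rsqr in V.
    assert (mu x * mu x * (v * v) <= 1 * (v * v)) by now apply Rmult_le_compat_r.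
    simpl; lra. }
  assert (P : 0 < x ^ l) by (apply pow_lt; lra).
  assert (Pl : x ^ l <= la ^ l) by (apply pow_incr; unfold la; lra).
  rewrite G, Rpow_mult_distr in B.
  replace (g O) with (ex41_p (S s) x - mu x * ex41_p s x) in B
    by (unfold g; rewrite Nat.add_0_r; reflexivity).
  set (g0 := ex41_p (S s) x - mu x * ex41_p s x) in *.
  assert (0 <= g0 ^ 2) by apply pow2_ge_0.
  assert (x ^ l * x ^ l <= (la ^ l) ^ 2) by (simpl; rewrite Rmult_1_r; apply Rmult_le_compat; lra).
  assert (x ^ l * x ^ l * g0 ^ 2 <= (la ^ l) ^ 2 * g0 ^ 2) by now apply Rmult_le_compat_r.
  apply (Rmult_le_reg_l (x ^ l)); [exact P|lra].
Qed.

(** * The angle relative to the decaying solution *)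

Lemma p_continuous (n : nat) (x : R) : continuity_pt (ex41_p n) x.
Proof.
  destruct (confluent_christoffel_darboux n x) as (d0 & _ & H & _).
  apply derivable_continuous_pt; now exists d0.
Qed.

Lemma K_continuous (n : nat) (x : R) : continuity_pt (fun x => ex41_K n x x) x.
Proof.
  induction n as [|n IH]; unfold ex41_K; simpl.
  - apply (continuity_pt_mult (ex41_p 0) (ex41_p 0)); apply p_continuous.
  - apply (continuity_pt_plus (fun x => ex41_K n x x)
             (fun x => ex41_p (S n) x * ex41_p (S n) x)); [exact IH|].
    apply (continuity_pt_mult (ex41_p (S n)) (ex41_p (S n))); apply p_continuous.
Qed.

Lemma mu_continuous (x : R) : 1 < x -> continuity_pt mu x.
Proof.
  intros Hx; destruct (mu_derivative x Hx) as (m & Hm & _).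
  apply derivable_continuous_pt; now exists m.
Qed.

(** At a zero of [ex41_p s] the quotient carries no information; only the bounds of [atan] are used
    there. *)
Definition angle (s : nat) (d x : R) : R :=
  atan ((ex41_p (S s) x / ex41_p s x - mu x) / d).

(** The derivative of [angle] with $a_{s+1}$ replaced by 1 and the derivative of [mu] by 0. Both
    changes lower it, and the result stays continuous across the zeros of [ex41_p s]. *)
Definition angle_speed (s : nat) (d x : R) : R :=
  d * ex41_K s x x /
  (d * d * (ex41_p s x * ex41_p s x) +
   (ex41_p (S s) x - mu x * ex41_p s x) * (ex41_p (S s) x - mu x * ex41_p s x)).

Lemma p_no_common_zero (s : nat) (x : R) :
  ex41_p s x = 0 -> ex41_p (S s) x <> 0.
Proof.
  intros E0 E1.
  destruct (confluent_christoffel_darboux s x) as (d0 & d1 & _ & _ & E).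
  rewrite E0, E1 in E; pose proof (K_ge_1 s x); lra.
Qed.

Lemma angle_denominator_pos (s : nat) (d x : R) :
  0 < d ->
  0 < d * d * (ex41_p s x * ex41_p s x) +
   (ex41_p (S s) x - mu x * ex41_p s x) * (ex41_p (S s) x - mu x * ex41_p s x).
Proof.
  intros Hd.
  destruct (Req_dec (ex41_p s x) 0) as [E|E].
  - pose proof (p_no_common_zero s x E); rewrite E.
    pose proof (Rsqr_pos_lt _ H) as Q; unfold Rsqr in Q; lra.
  - pose proof (Rsqr_pos_lt _ E) as Q; unfold Rsqr in Q.
    pose proof (Rle_0_sqr (ex41_p (S s) x - mu x * ex41_p s x)) as V; unfold Rsqr in V.
    assert (0 < d * d * (ex41_p s x * ex41_p s x)) by (apply Rmult_lt_0_compat; [nra|exact Q]).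
    lra.
Qed.

Lemma angle_speed_continuous (s : nat) (d x : R) :
  0 < d -> 1 < x -> continuity_pt (angle_speed s d) x.
Proof.
  intros Hd Hx; unfold angle_speed.
  assert (C : continuity_pt (fun x => ex41_p (S s) x - mu x * ex41_p s x) x).
  { apply (continuity_pt_minus (ex41_p (S s)) (fun x => mu x * ex41_p s x));
      [apply p_continuous|].
    apply (continuity_pt_mult mu (ex41_p s)); [now apply mu_continuous|apply p_continuous]. }
  apply (continuity_pt_div (fun x => d * ex41_K s x x)
    (fun x => d * d * (ex41_p s x * ex41_p s x) +
      (ex41_p (S s) x - mu x * ex41_p s x) * (ex41_p (S s) x - mu x * ex41_p s x))).
  - apply (continuity_pt_scal (fun x => ex41_K s x x)), K_continuous.
  - apply (continuity_pt_plus (fun x => d * d * (ex41_p s x * ex41_p s x))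
      (fun x => (ex41_p (S s) x - mu x * ex41_p s x) * (ex41_p (S s) x - mu x * ex41_p s x))).
    + apply (continuity_pt_scal (fun x => ex41_p s x * ex41_p s x)).
      apply (continuity_pt_mult (ex41_p s) (ex41_p s)); apply p_continuous.
    + now apply (continuity_pt_mult (fun x => ex41_p (S s) x - mu x * ex41_p s x)
                   (fun x => ex41_p (S s) x - mu x * ex41_p s x)).
  - now apply Rgt_not_eq, angle_denominator_pos.
Qed.

Lemma angle_derivative (s : nat) (d x : R) :
  0 < d -> 1 < x -> ex41_p s x <> 0 ->
  exists D, derivable_pt_lim (angle s d) x D /\ angle_speed s d x <= D.
Proof.
  intros Hd Hx Hp.
  destruct (confluent_christoffel_darboux s x) as (d0 & d1 & H0 & H1 & E).
  destruct (mu_derivative x Hx) as (m & Hm & Hm0).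
  set (y := (ex41_p (S s) x / ex41_p s x - mu x) / d).
  set (v := ((d1 * ex41_p s x - d0 * ex41_p (S s) x) / Rsqr (ex41_p s x) - m) * / d).
  exists (/ (1 + y ^ 2) * v); split.
  - apply (derivable_pt_lim_comp
      (fun x => (ex41_p (S s) x / ex41_p s x - mu x) / d) atan).
    + unfold v.
      rewrite (functional_extensionality _
        (fun x => / d * (ex41_p (S s) x / ex41_p s x - mu x)))
        by (intros z; unfold Rdiv; ring).
      rewrite Rmult_comm.
      apply (derivable_pt_lim_scal (fun x => ex41_p (S s) x / ex41_p s x - mu x)).
      apply (derivable_pt_lim_minus (fun x => ex41_p (S s) x / ex41_p s x) mu); [|exact Hm].
      now apply (derivable_pt_lim_div (ex41_p (S s)) (ex41_p s)).
    + fold y; apply derivable_pt_lim_atan.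
  - rewrite <- Rsqr_pow2.
    pose proof (angle_denominator_pos s d x Hd) as Dp.
    pose proof (K_ge_1 s x) as K1.
    pose proof (a_bounds (S s)).
    assert (W : ex41_K s x x <= d1 * ex41_p s x - d0 * ex41_p (S s) x) by nra.
    pose proof (Rsqr_pos_lt _ Hp) as P2.
    assert (V : ex41_K s x x * / Rsqr (ex41_p s x) * / d <= v).
    { unfold v; apply Rmult_le_compat_r; [now apply Rlt_le, Rinv_0_lt_compat|].
      assert (ex41_K s x x * / Rsqr (ex41_p s x) <=
        (d1 * ex41_p s x - d0 * ex41_p (S s) x) * / Rsqr (ex41_p s x)).
      { apply Rmult_le_compat_r; [now apply Rlt_le, Rinv_0_lt_compat|exact W]. }
      unfold Rdiv; lra. }
    assert (Y : 0 < 1 + Rsqr y) by (pose proof (Rle_0_sqr y); lra).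
    apply Rle_trans with (/ (1 + Rsqr y) * (ex41_K s x x * / Rsqr (ex41_p s x) * / d)).
    + apply Req_le; unfold angle_speed.
      replace (1 + Rsqr y) with
        ((d * d * (ex41_p s x * ex41_p s x) +
          (ex41_p (S s) x - mu x * ex41_p s x) * (ex41_p (S s) x - mu x * ex41_p s x))
         / (d * d * (ex41_p s x * ex41_p s x)))
        by (unfold y, Rsqr; field; lra).
      unfold Rsqr; field; repeat split; lra.
    + apply Rmult_le_compat_l; [now apply Rlt_le, Rinv_0_lt_compat|exact V].
Qed.

Lemma angle_increment (s : nat) (d c x y : R) :
  0 < d -> 1 < x -> x < y ->
  (forall z, x <= z <= y -> ex41_p s z <> 0) ->
  (forall z, x <= z <= y -> c <= angle_speed s d z) ->
  c * (y - x) <= angle s d y - angle s d x.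
Proof.
  intros Hd Hx Hxy Hp Hc.
  (* The mean value theorem asks for a derivative function, so one is chosen pointwise; its values
     outside the interval are arbitrary. *)
  set (f' := fun z => epsilon (inhabits 0)
    (fun D => derivable_pt_lim (angle s d) z D /\ angle_speed s d z <= D)).
  assert (F : forall z, x <= z <= y ->
    derivable_pt_lim (angle s d) z (f' z) /\ angle_speed s d z <= f' z).
  { intros z Hz.
    apply (epsilon_spec (inhabits 0)
      (fun D => derivable_pt_lim (angle s d) z D /\ angle_speed s d z <= D)).
    apply angle_derivative; [exact Hd|lra|auto]. }
  destruct (MVT_cor2 (angle s d) f' x y Hxy) as (z & Ez & Hz); [intros; now apply F|].
  rewrite Ez; apply Rmult_le_compat_r; [lra|].
  apply Rle_trans with (angle_speed s d z); [apply Hc; lra|apply F; lra].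
Qed.

(** The rational bound 2 for [PI / 2] comes from [PI <= 4]. *)
Lemma angle_bounds (s : nat) (d x : R) : -2 < angle s d x < 2.
Proof.
  pose proof (atan_bound ((ex41_p (S s) x / ex41_p s x - mu x) / d)).
  pose proof PI_4; unfold angle; lra.
Qed.

(** Cells near the set are paid for by the increase of the angle, except the at most [2 * s] cells
    with a zero, which are paid for separately. The interval [[u, u + 1]] is used because it
    contains [[u, 2]]. *)
Lemma cover_decaying (s : nat) (d u : R) :
  0 < d -> 1 < u ->
  exists l, wf l /\ total l <= 100 * d * (1 + INR s) /\
    covers l (fun x => u <= x <= 2 /\
      (ex41_p (S s) x - mu x * ex41_p s x) ^ 2 <= d * d * ex41_K s x x).
Proof.
  intros Hd Hu.
  (* On the set the speed is at least [1 / (2 d)]; an oscillation below [1 / (6 d)] leaves at least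
     [1 / (3 d)] on the whole cell. *)
  assert (He : 0 < / (6 * d)) by (apply Rinv_0_lt_compat; lra).
  assert (Hc : forall x, u <= x <= u + 1 -> continuity_pt (angle_speed s d) x)
    by (intros x Hx; apply angle_speed_continuous; lra).
  destruct (Heine_cor2 Hc (mkposreal _ He)) as [h Hh].
  destruct (archimed_cor1 (Rmin d h)) as (n & Hn & Hn0).
  { apply Rmin_pos; [exact Hd|apply cond_pos]. }
  assert (Hn' : 0 < INR n) by now apply lt_0_INR.
  set (w := / INR n) in *.
  assert (Hw : 0 < w) by now apply Rinv_0_lt_compat.
  assert (wd : w < d) by (eapply Rlt_le_trans; [exact Hn|apply Rmin_l]).
  assert (wh : w < h) by (eapply Rlt_le_trans; [exact Hn|apply Rmin_r]).
  set (t := fun i => u + INR i * w).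
  assert (tS : forall i, t (S i) = t i + w) by (intros i; unfold t; rewrite S_INR; ring).
  assert (tn : t n = u + 1) by (unfold t, w; field; lra).
  assert (tb : forall i, (i < n)%nat -> u <= t i /\ t (S i) <= u + 1).
  { intros i Hi; rewrite <- tn; unfold t; split.
    - pose proof (Rmult_le_pos (INR i) w (pos_INR i)); lra.
    - apply Rplus_le_compat_l, Rmult_le_compat_r; [lra|apply le_INR; lia]. }
  set (bad := fun i => exists z, t i <= z <= t (S i) /\ ex41_p s z = 0).
  set (F := fun i => angle s d (t i)).
  (* A cell free of zeros has [F] increasing; a cell with a zero may lose up to [4 > PI]. *)
  set (c := fun i => 3 * d * (F (S i) - F i) + (w + 12 * d) * ind (bad i)).
  assert (Fi : forall i, F (S i) - F i <= 4 /\ -4 <= F (S i) - F i).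
  { intros i; pose proof (angle_bounds s d (t i)); pose proof (angle_bounds s d (t (S i))).
    unfold F; lra. }
  assert (Sp : forall x, 0 <= angle_speed s d x).
  { intros x; pose proof (angle_denominator_pos s d x Hd); pose proof (K_ge_1 s x).
    apply Rmult_le_pos; [nra|now apply Rlt_le, Rinv_0_lt_compat]. }
  set (A := fun x => u <= x <= 2 /\
      (ex41_p (S s) x - mu x * ex41_p s x) ^ 2 <= d * d * ex41_K s x x).
  (* On [A] both terms of the denominator of the speed are at most [d * d * ex41_K s x x]. *)
  assert (SpA : forall x, A x -> / (2 * d) <= angle_speed s d x).
  { intros x [_ Hx]; pose proof (angle_denominator_pos s d x Hd) as Dp.
    pose proof (K_ge_1 s x); pose proof (K_ge_p s x) as Kp.
    assert (d * d * (ex41_p s x * ex41_p s x) <= d * d * ex41_K s x x)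
      by (apply Rmult_le_compat_l; [nra|simpl in Kp; lra]).
    unfold angle_speed; set (D := d * d * _ + _) in *.
    assert (D <= 2 * (d * d * ex41_K s x x)) by (unfold D; simpl in Hx; lra).
    apply (Rmult_le_reg_r D); [exact Dp|].
    unfold Rdiv; rewrite Rmult_assoc, Rinv_l, Rmult_1_r by lra.
    apply (Rmult_le_reg_l (2 * d)); [lra|].
    rewrite <- Rmult_assoc, Rinv_r by lra; lra. }
  destruct (covers_cells A t w c n Hw tS) as (l & Wl & Tl & Cl).
  - intros i Hi; destruct (tb i Hi); unfold c; specialize (Fi i).
    destruct (excluded_middle_informative (bad i)) as [B|B].
    + rewrite (ind_true _ B); nra.
    + rewrite (ind_false _ B).
      pose proof (angle_increment s d 0 (t i) (t (S i)) Hd) as I.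
      enough (0 <= F (S i) - F i) by nra.
      unfold F; rewrite <- (Rmult_0_l (t (S i) - t i)).
      apply I; [lra|rewrite tS; lra| |intros; apply Sp].
      intros z Hz Ez; apply B; now exists z.
  - intros i Hi (x & Ax & Hx); destruct (tb i Hi); unfold c; specialize (Fi i).
    destruct (excluded_middle_informative (bad i)) as [B|B].
    + rewrite (ind_true _ B); nra.
    + rewrite (ind_false _ B).
      pose proof (angle_increment s d (/ (3 * d)) (t i) (t (S i)) Hd) as I.
      assert (/ (3 * d) * w <= F (S i) - F i).
      { unfold F; replace w with (t (S i) - t i) by (rewrite tS; ring).
        apply I; [lra|rewrite tS; lra| |].
        - intros z Hz Ez; apply B; now exists z.
        - intros z Hz; rewrite tS in *.
          pose proof (SpA x Ax).
          assert (Rabs (angle_speed s d x - angle_speed s d z) < / (6 * d)).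
          { apply Hh; [lra|lra|]; apply Rabs_def1; lra. }
          pose proof (Rle_abs (angle_speed s d x - angle_speed s d z)).
          replace (/ (2 * d)) with (3 * / (6 * d)) in * by (field; lra).
          replace (/ (3 * d)) with (2 * / (6 * d)) by (field; lra); lra. }
      assert (3 * d * (/ (3 * d) * w) <= 3 * d * (F (S i) - F i))
        by (apply Rmult_le_compat_l; lra).
      rewrite <- Rmult_assoc, Rinv_r in * by lra; lra.
  - exists l; split; [exact Wl|split].
    (* The increments telescope to at most 4 and [w + 12 * d <= 13 * d], so the total is at most
       [3 * (12 * d + 26 * d * INR s)], below the claimed bound. *)
    + eapply Rle_trans; [exact Tl|].
      unfold c; rewrite rsum_plus, !rsum_scal, rsum_telescope.
      assert (Bd : rsum (fun i => ind (bad i)) n <= 2 * INR s).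
      { apply grid_count_roots; [intros i; rewrite tS; lra|apply p_polyfun|].
        (* If the polynomial vanished identically, so would its derivative at 0, and the confluent
           formula would give $K_s(0,0) = 0$. *)
        destruct (Req_dec (ex41_p s 0) 0) as [E|E]; [|now exists 0].
        destruct (confluent_christoffel_darboux s 0) as (d0 & d1 & H0 & _ & EK).
        apply NNPP; intros N.
        assert (Z : ex41_p s = fun _ => 0)
          by (apply functional_extensionality; intros z; apply NNPP; intros Q; apply N; now exists z).
        rewrite Z in H0; pose proof (uniqueness_limite _ _ _ _ H0 (derivable_pt_lim_const 0 0)).
        subst d0; rewrite E in EK; pose proof (K_ge_1 s 0); lra. }
      pose proof (pos_INR s).
      assert (F n - F O <= 4).
      { pose proof (angle_bounds s d (t n)); pose proof (angle_bounds s d (t O)); unfold F; lra. }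
      assert ((w + 12 * d) * rsum (fun i => ind (bad i)) n <= (13 * d) * (2 * INR s)).
      { apply Rle_trans with ((w + 12 * d) * (2 * INR s)).
        - apply Rmult_le_compat_l; lra.
        - apply Rmult_le_compat_r; lra. }
      nra.
    + intros x Hx; apply Cl; split; [exact Hx|].
      destruct Hx as [Hx _]; rewrite tn; unfold t; simpl; lra.
Qed.

(** * Smallness of the exceptional sets *)

(** The ratio of consecutive terms is [9 * q ^ (2 ^ J)], which is below 1/2 once the power of [q] is
    below 1/18. *)
Lemma superexponential_decay (q e : R) :
  0 < q < 1 -> 0 < e ->
  exists J0, forall J, (J0 <= J)%nat -> 9 ^ J * q ^ (2 ^ J) <= e.
Proof.
  intros Hq He.
  assert (Pow : forall r y, 0 < r < 1 -> 0 < y ->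
            exists N, forall n, (N <= n)%nat -> 0 < r ^ n < y).
  { intros r y Hr Hy.
    destruct (pow_lt_1_zero r) with (y := y) as [N HN]; [rewrite Rabs_right; lra|lra|].
    exists N; intros n Hn; assert (0 < r ^ n) by (apply pow_lt; lra).
    specialize (HN n Hn); rewrite Rabs_right in HN; lra. }
  destruct (Pow q (/ 18) Hq ltac:(lra)) as [J1 H1].
  set (v := fun J => 9 ^ J * q ^ (2 ^ J)).
  assert (vpos : forall J, 0 < v J)
    by (intros J; apply Rmult_lt_0_compat; apply pow_lt; lra).
  assert (Hv : forall k, v (J1 + k)%nat <= v J1 * (/ 2) ^ k).
  { intros k; induction k as [|k IH]; [rewrite Nat.add_0_r; simpl; lra|].
    assert (v (J1 + S k)%nat = 9 * v (J1 + k)%nat * q ^ (2 ^ (J1 + k))).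
    { unfold v; rewrite Nat.add_succ_r, Nat.pow_succ_r'.
      replace (2 * 2 ^ (J1 + k))%nat with (2 ^ (J1 + k) + 2 ^ (J1 + k))%nat by lia.
      rewrite pow_add; simpl; ring. }
    destruct (H1 (2 ^ (J1 + k))%nat) as [P Q].
    { pose proof (Nat.pow_gt_lin_r 2 (J1 + k)); lia. }
    specialize (vpos (J1 + k)%nat); simpl; nra. }
  destruct (Pow (/ 2) (e / v J1)) as [k0 Hk0]; [lra| |].
  { apply Rdiv_lt_0_compat; auto. }
  exists (J1 + k0)%nat; intros J HJ.
  change (v J <= e).
  replace J with (J1 + (J - J1))%nat by lia.
  eapply Rle_trans; [apply Hv|].
  destruct (Hk0 (J - J1)%nat ltac:(lia)) as [_ H].
  specialize (vpos J1).
  apply Rle_trans with (v J1 * (e / v J1)); [apply Rmult_le_compat_l; lra|].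
  apply Req_le; field; lra.
Qed.

Lemma block_choice (u e : R) (i : nat) :
  1 < u -> 0 < e ->
  exists j, (i <= j)%nat /\
    100 * sqrt (2 * (/ u) ^ (clen j - 1)) * (1 + INR (cstart j)) <= e.
Proof.
  intros Hu He.
  assert (Hq : 0 < / u < 1).
  { split; [apply Rinv_0_lt_compat; lra|].
    rewrite <- Rinv_1; apply Rinv_lt_contravar; lra. }
  (* The two sides are compared after squaring: [720000 = 100^2 * 6^2 * 2], where 6 comes from
     [1 + INR (cstart j) <= 6 * 3 ^ J], and [u] makes up for the exponent [clen j - 1]. *)
  set (e' := e * e / (720000 * u)).
  assert (He' : 0 < e') by (apply Rdiv_lt_0_compat; nra).
  destruct (superexponential_decay (/ u) e' Hq He') as [J0 HJ].
  set (j := (i + J0)%nat); exists j; split; [lia|].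
  set (J := (S j * S j)%nat).
  specialize (HJ J ltac:(unfold J, j; nia)).
  set (r := 2 * (/ u) ^ (clen j - 1)).
  assert (r0 : 0 < r) by (apply Rmult_lt_0_compat; [lra|apply pow_lt; lra]).
  assert (rE : r = 2 * u * (/ u) ^ (2 ^ J)).
  { unfold r, clen; fold J.
    assert (2 ^ J <> 0)%nat by (apply Nat.pow_nonzero; lia).
    replace (2 ^ J)%nat with (S (2 ^ J - 1)) at 2 by lia.
    simpl; field; lra. }
  assert (B : 1 + INR (cstart j) <= 6 * 3 ^ J).
  { assert (cstart j <= 5 * 3 ^ J)%nat as C.
    { unfold cstart; fold J; pose proof (offset_le j).
      assert (3 ^ (j * j) <= 3 ^ J)%nat by (apply Nat.pow_le_mono_r; unfold J; nia).
      lia. }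
    apply le_INR in C; rewrite mult_INR, pow_INR in C.
    replace (INR 5) with 5 in C by (simpl; lra).
    replace (INR 3) with 3 in C by (simpl; lra).
    assert (1 <= 3 ^ J) by (apply pow_R1_Rle; lra); lra. }
  assert (P3 : 0 < 3 ^ J) by (apply pow_lt; lra).
  assert (S0 : 0 < sqrt r) by now apply sqrt_lt_R0.
  apply Rle_trans with (600 * (sqrt r * 3 ^ J)).
  - assert (sqrt r * (1 + INR (cstart j)) <= sqrt r * (6 * 3 ^ J))
      by (apply Rmult_le_compat_l; lra); lra.
  - apply Rsqr_incr_0; [|nra|lra].
    unfold Rsqr.
    replace (600 * (sqrt r * 3 ^ J) * (600 * (sqrt r * 3 ^ J)))
      with (360000 * (sqrt r * sqrt r) * (3 ^ J * 3 ^ J)) by ring.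
    rewrite sqrt_sqrt by lra; rewrite <- Rpow_mult_distr; replace (3 * 3) with 9 by ring.
    rewrite rE.
    replace (e * e) with (720000 * u * e') by (unfold e'; field; lra).
    replace (360000 * (2 * u * (/ u) ^ 2 ^ J) * 9 ^ J)
      with (720000 * u * (9 ^ J * (/ u) ^ 2 ^ J)) by ring.
    apply Rmult_le_compat_l; [nra|exact HJ].
Qed.

(** One index bounds both the distance of [|x|] from 1 and the place from which the inequality
    holds, so the Nevai points lie in a countable union of such sets. *)
Definition slow_growth (i : nat) (x : R) : Prop :=
  1 + / (INR i + 1) <= Rabs x <= 2 /\
  forall n, (i <= n)%nat ->
    ex41_p n x ^ 2 + ex41_p (S n) x ^ 2 <= (Rabs x - 1) * ex41_K n x x.

Lemma slow_growth_opp (i : nat) (x : R) : slow_growth i x -> slow_growth i (- x).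
Proof.
  intros [Hx H]; split; [now rewrite Rabs_Ropp|].
  intros n Hn; rewrite Rabs_Ropp, !p_sq_opp, K_opp; auto.
Qed.

(** A late enough block is used with [d^2 = 2 / u^l], which dominates the bound [2 / x^l] from
    [block_growth] for every [x >= u]. *)
Lemma slow_growth_cover (i : nat) (e : R) :
  0 < e -> exists l, wf l /\ total l <= e /\ covers l (slow_growth i).
Proof.
  intros He.
  set (u := 1 + / (INR i + 1)).
  assert (Hu : 1 < u).
  { assert (0 < / (INR i + 1)); [|unfold u; lra].
    apply Rinv_0_lt_compat; pose proof (pos_INR i); lra. }
  (* Half of [e] is for the positive points, half for their reflections. *)
  destruct (block_choice u (e / 2) i Hu ltac:(lra)) as (j & Hj & Ej).
  set (l := (clen j - 1)%nat) in *; set (s := cstart j) in *.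
  assert (r0 : 0 < 2 * (/ u) ^ l).
  { apply Rmult_lt_0_compat; [lra|apply pow_lt, Rinv_0_lt_compat; lra]. }
  assert (c0 : clen j <> 0%nat) by (apply Nat.pow_nonzero; lia).
  destruct (cover_decaying s (sqrt (2 * (/ u) ^ l)) u) as (m & Wm & Tm & Cm);
    [now apply sqrt_lt_R0|exact Hu|].
  rewrite sqrt_sqrt in Cm by lra.
  assert (C : covers m (fun x => slow_growth i x /\ 0 < x)).
  { intros x [[Hx H] x0]; apply Cm.
    rewrite Rabs_right in * by lra; fold u in Hx; split; [exact Hx|].
    assert (B := block_growth s l x ltac:(lra)).
    assert (B' : (ex41_p (S s) x - mu x * ex41_p s x) ^ 2 * x ^ l <= 2 * ex41_K s x x).
    { apply B.
      - intros n Hn; apply (a_on_C j); fold s; unfold l in Hn; lia.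
      - intros n Hn; apply H.
        assert (j <= s)%nat by (unfold s, cstart; pose proof (offset_ge j); lia); lia. }
    set (G := (ex41_p (S s) x - mu x * ex41_p s x) ^ 2) in *.
    assert (0 <= G) by apply pow2_ge_0.
    assert (u ^ l <= x ^ l) by (apply pow_incr; lra).
    assert (0 < u ^ l) by (apply pow_lt; lra).
    assert (G * u ^ l <= G * x ^ l) by (apply Rmult_le_compat_l; lra).
    apply (Rmult_le_reg_r (u ^ l)); [lra|].
    rewrite pow_inv; replace (2 * / u ^ l * ex41_K s x x * u ^ l) with (2 * ex41_K s x x)
      by (field; lra); lra. }
  destruct (covers_reflect m _ Wm C) as (m' & Wm' & Tm' & Cm').
  exists (m ++ m'); split; [now apply wf_app|split].
  - rewrite total_app; lra.
  - intros x Hx; destruct (Rlt_le_dec 0 x) as [P|P].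
    + destruct (C x (conj Hx P)) as (ab & Hab & Hi).
      exists ab; split; [apply in_or_app; now left|exact Hi].
    + destruct (Cm' x) as (ab & Hab & Hi).
      * split; [now apply slow_growth_opp|].
        destruct (Req_dec x 0) as [->|]; [|lra].
        destruct Hx as [Hx _]; rewrite Rabs_R0 in Hx; fold u in Hx; lra.
      * exists ab; split; [apply in_or_app; now right|exact Hi].
Qed.

(** * Orthonormality and the spectral integral *)

Lemma polyfun_continuous (d : nat) (f : R -> R) : polyfun d f -> continuity f.
Proof.
  revert f; induction d as [|d IH]; intros f.
  - intros [c Hc]; rewrite (functional_extensionality _ _ Hc).
    now apply continuity_const.
  - intros (c & g & Hg & E); rewrite (functional_extensionality _ _ E).
    apply (continuity_plus (fun _ => c) (fun x => x * g x)); [now apply continuity_const|].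
    apply (continuity_mult (fun x => x) g); [|now apply IH].
    apply derivable_continuous, derivable_id.
Qed.

Lemma p_continuity (n : nat) : continuity (ex41_p n).
Proof. exact (p_continuous n). Qed.

(** The matrix has row sums at most 2, hence norm at most 2 for the supremum norm. *)
Lemma jac_pow_bound (n k : nat) : Rabs (jac_pow_delta1 n k) <= 2 ^ n.
Proof.
  revert k; induction n as [|n IH]; intros k; simpl.
  - unfold delta1; destruct (Nat.eqb k 1); rewrite ?Rabs_R0, ?Rabs_R1; lra.
  - assert (P : 0 < 2 ^ n) by (apply pow_lt; lra).
    destruct k as [|k]; simpl; [rewrite Rabs_R0; lra|].
    unfold ex41_b; rewrite Rmult_0_l, Rplus_0_r.
    eapply Rle_trans; [apply Rabs_triang|]; rewrite !Rabs_mult.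
    pose proof (a_bounds k); pose proof (a_bounds (S k)).
    rewrite (Rabs_right (ex41_a k)), (Rabs_right (ex41_a (S k))) by lra.
    pose proof (IH (S (S k))); pose proof (Rabs_pos (jac_pow_delta1 n (S (S k)))).
    assert (Rabs (match k with O => 0 | S _ => jac_pow_delta1 n k end) <= 2 ^ n)
      by (destruct k; [rewrite Rabs_R0; lra|apply IH]).
    pose proof (Rabs_pos (match k with O => 0 | S _ => jac_pow_delta1 n k end)).
    nra.
Qed.

Lemma L_lin (L : (R -> R) -> R) (u v : R) (f g : R -> R) :
  is_spectral_integral L -> continuity f -> continuity g ->
  L (fun x => u * f x + v * g x) = u * L f + v * L g.
Proof.
  intros (Ladd & Lscal & _) Cf Cg.
  rewrite (Ladd (fun x => u * f x) (fun x => v * g x)), !Lscal; auto.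
  - now apply (continuity_scal f).
  - now apply (continuity_scal g).
Qed.

Lemma L_mono (L : (R -> R) -> R) (f g : R -> R) :
  is_spectral_integral L -> continuity f -> continuity g ->
  (forall x, f x <= g x) -> L f <= L g.
Proof.
  intros HL Cf Cg H.
  pose proof (L_lin L 1 (-1) g f HL Cg Cf) as E.
  destruct HL as (_ & _ & Lpos & _).
  assert (0 <= L (fun x => 1 * g x + -1 * f x)); [|lra].
  apply Lpos.
  - apply (continuity_plus (fun x => 1 * g x) (fun x => -1 * f x));
      [now apply (continuity_scal g)|now apply (continuity_scal f)].
  - intros x; specialize (H x); lra.
Qed.

Lemma pow_continuity (k : nat) : continuity (fun x => x ^ k).
Proof. apply derivable_continuous, derivable_pow. Qed.

(** This expresses $p_n(J)\delta_1 = \delta_{n+1}$ through moments: the recurrence for $p_n$ is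
    matched with the action of $J$ on coordinate $n+1$, for all [k] at once. *)
Lemma L_pow_p (L : (R -> R) -> R) (n k : nat) :
  is_spectral_integral L ->
  L (fun x => x ^ k * ex41_p n x) = jac_pow_delta1 k (S n).
Proof.
  intros HL.
  enough (forall k, L (fun x => x ^ k * ex41_p n x) = jac_pow_delta1 k (S n) /\
            L (fun x => x ^ k * ex41_p (S n) x) = jac_pow_delta1 k (S (S n))) by apply H.
  assert (C : forall n k, continuity (fun x => x ^ k * ex41_p n x)).
  { intros; apply (continuity_mult (fun x => x ^ k0) (ex41_p n0));
      [apply pow_continuity|apply p_continuity]. }
  induction n as [|n IH]; clear k; intros k.
  - assert (M : forall k, L (fun x => x ^ k * ex41_p 0 x) = jac_pow_delta1 k 1).
    { intros m; destruct HL as (_ & _ & _ & Hm); rewrite <- (Hm m : _ = jac_pow_delta1 m 1).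
      f_equal; apply functional_extensionality; intros x; rewrite p_0; ring. }
    split; [apply M|].
    pose proof (M (S k)) as E.
    (* The summand with coefficient 0 only gives the expression the shape of [L_lin]. *)
    replace (fun x => x ^ S k * ex41_p 0 x) with
      (fun x => ex41_a 1 * (x ^ k * ex41_p 1 x) + 0 * (x ^ k * ex41_p 1 x)) in E.
    + rewrite L_lin in E by auto.
      simpl in E; unfold ex41_b in E; pose proof (a_bounds 1).
      apply (Rmult_eq_reg_l (ex41_a 1)); lra.
    + apply functional_extensionality; intros x.
      pose proof (p_1 x) as Q; simpl pow.
      transitivity (x ^ k * (ex41_a 1 * ex41_p 1 x)); [ring|rewrite <- Q; ring].
  - split; [apply IH|].
    destruct (IH (S k)) as [_ E].
    replace (fun x => x ^ S k * ex41_p (S n) x) with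
      (fun x => ex41_a (S (S n)) * (x ^ k * ex41_p (S (S n)) x)
                + ex41_a (S n) * (x ^ k * ex41_p n x)) in E.
    + rewrite L_lin in E by auto.
      destruct (IH k) as [E0 _]; rewrite E0 in E.
      change (jac_pow_delta1 (S k) (S (S n))) with
        (ex41_a (S n) * jac_pow_delta1 k (S n) + 0 * jac_pow_delta1 k (S (S n))
         + ex41_a (S (S n)) * jac_pow_delta1 k (S (S (S n)))) in E.
      pose proof (a_bounds (S (S n))).
      apply (Rmult_eq_reg_l (ex41_a (S (S n)))); lra.
    + apply functional_extensionality; intros x.
      pose proof (p_SS n x) as Q; simpl pow.
      transitivity (x ^ k * (x * ex41_p (S n) x)); [rewrite Q; ring|ring].
Qed.

Definition kron (m n : nat) : R := if Nat.eqb m n then 1 else 0.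

(** Expanding $\int x p_m p_n$ by the recurrence in either factor gives a relation for the Gram
    matrix that the identity matrix also satisfies. Row 0 then determines all rows. *)
Lemma L_p_p (L : (R -> R) -> R) (m n : nat) :
  is_spectral_integral L -> L (fun x => ex41_p m x * ex41_p n x) = kron m n.
Proof.
  intros HL.
  assert (C : forall m n, continuity (fun x => ex41_p m x * ex41_p n x)).
  { intros m' n'; apply (continuity_mult (ex41_p m') (ex41_p n')); apply p_continuity. }
  (* The term of lower index in the recurrence, with value 0 at index 0 because $p_{-1} = 0$. *)
  set (low := fun h : nat -> R => fun n => match n with O => 0 | S n' => ex41_a n * h n' end).
  set (M := fun m n => L (fun x => ex41_p m x * ex41_p n x)).
  assert (Sym : forall m n, M m n = M n m).
  { intros; unfold M; f_equal; apply functional_extensionality; intros; ring. }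
  assert (X : forall m n, L (fun x => x * ex41_p m x * ex41_p n x) =
             ex41_a (S m) * M (S m) n + low (fun m' => M m' n) m).
  { intros m' n'; destruct m' as [|m']; simpl.
    - rewrite Rplus_0_r; unfold M; rewrite <- (Rplus_0_r (_ * _)).
      rewrite <- (Rmult_0_l (L (fun x => ex41_p 1 x * ex41_p n' x))).
      rewrite <- L_lin by auto; f_equal; apply functional_extensionality; intros x.
      rewrite p_1; ring.
    - unfold M; rewrite <- L_lin by auto; f_equal; apply functional_extensionality; intros x.
      rewrite p_SS; ring. }
  assert (Rec : forall m n, ex41_a (S m) * M (S m) n + low (fun m' => M m' n) m =
                 ex41_a (S n) * M m (S n) + low (M m) n).
  { intros m' n'; rewrite <- X.
    replace (fun x => x * ex41_p m' x * ex41_p n' x) with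
      (fun x => x * ex41_p n' x * ex41_p m' x)
      by (apply functional_extensionality; intros; ring).
    rewrite X, Sym; f_equal; destruct n'; simpl; [reflexivity|now rewrite Sym]. }
  change (M m n = kron m n); revert n.
  enough (forall n, M m n = kron m n /\ M (S m) n = kron (S m) n) by apply H.
  assert (M0 : forall n, M O n = kron O n).
  { intros n; unfold M.
    pose proof (L_pow_p L n 0 HL) as E.
    replace (fun x => x ^ 0 * ex41_p n x) with (fun x => ex41_p 0 x * ex41_p n x) in E.
    - rewrite E; destruct n; reflexivity.
    - apply functional_extensionality; intros x; rewrite p_0; reflexivity. }
  assert (Kd : forall m n, low (fun m' => kron m' n) m + ex41_a (S m) * kron (S m) n =
               ex41_a (S n) * kron m (S n) + low (kron m) n).
  { intros m' n'.
    assert (K1 : low (fun i => kron i n') m' = ex41_a (S n') * kron m' (S n')).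
    { unfold kron; destruct m' as [|m']; simpl; [ring|].
      destruct (Nat.eqb_spec m' n') as [->|]; ring. }
    assert (K2 : low (kron m') n' = ex41_a (S m') * kron (S m') n').
    { unfold kron; destruct n' as [|n']; simpl; [ring|].
      destruct (Nat.eqb_spec m' n') as [->|]; ring. }
    rewrite K1, K2; reflexivity. }
  assert (St : forall m, (forall n, M m n = kron m n) ->
            (forall n, low (fun m' => M m' n) m = low (fun m' => kron m' n) m) ->
            forall n, M (S m) n = kron (S m) n).
  { intros m' H1 H2 n'; specialize (Rec m' n'); specialize (Kd m' n').
    rewrite H1, H2 in Rec.
    replace (low (M m') n') with (low (kron m') n') in Rec
      by (destruct n'; simpl; [reflexivity|now rewrite H1]).
    pose proof (a_bounds (S m')); apply (Rmult_eq_reg_l (ex41_a (S m'))); lra. }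
  induction m as [|m IH]; intros n.
  - split; [apply M0|apply St; [exact M0|reflexivity]].
  - split; [apply IH|].
    apply St; [apply IH|].
    intros n'; simpl; now rewrite (proj1 (IH n')).
Qed.

Lemma L_square (L : (R -> R) -> R) (n : nat) (u v : R) :
  is_spectral_integral L ->
  L (fun x => (u * ex41_p (S n) x + v * ex41_p n x) ^ 2) = u ^ 2 + v ^ 2.
Proof.
  intros HL.
  assert (C : forall m n, continuity (fun x => ex41_p m x * ex41_p n x)).
  { intros m' n'; apply (continuity_mult (ex41_p m') (ex41_p n')); apply p_continuity. }
  set (h := fun x => v ^ 2 * (ex41_p n x * ex41_p n x)
                     + (2 * u * v) * (ex41_p (S n) x * ex41_p n x)).
  assert (Ch : continuity h).
  { apply (continuity_plus (fun x => v ^ 2 * (ex41_p n x * ex41_p n x))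
      (fun x => (2 * u * v) * (ex41_p (S n) x * ex41_p n x))).
    - apply (continuity_scal (fun x => ex41_p n x * ex41_p n x)); auto.
    - apply (continuity_scal (fun x => ex41_p (S n) x * ex41_p n x)); auto. }
  transitivity (L (fun x => u ^ 2 * (ex41_p (S n) x * ex41_p (S n) x) + 1 * h x)).
  - f_equal; apply functional_extensionality; intros x; unfold h; ring.
  - rewrite L_lin by auto; unfold h; rewrite L_lin by auto; rewrite !L_p_p by exact HL.
    unfold kron; rewrite !Nat.eqb_refl.
    destruct (Nat.eqb_spec (S n) n); [lia|ring].
Qed.

(* The moments grow like [2 ^ n], so the spectral measure does not charge [|x| > 3]. *)
Lemma L_nonpos (L : (R -> R) -> R) (g : R -> R) (C : R) (d : nat) :
  is_spectral_integral L -> continuity g -> 0 <= C ->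
  (forall x, Rabs x <= 3 -> g x <= 0) ->
  (forall x, 3 <= Rabs x -> g x <= C * Rabs x ^ (2 * d)) ->
  L g <= 0.
Proof.
  intros HL Cg HC H1 H2.
  assert (Sq : forall x, Rabs x ^ 2 = x ^ 2) by (intros x; rewrite pow2_abs; reflexivity).
  assert (B : forall m, L g <= C * 4 ^ d * (4 / 9) ^ m).
  { intros m.
    (* The majorant is [C * x^(2d) * (x^2 / 9)^m]: nonnegative everywhere, and above [g] for
       [|x| >= 3] because the last factor is then at least 1. *)
    apply Rle_trans with (L (fun x => C * (/ 9) ^ m * x ^ (2 * (d + m)))).
    - apply L_mono; [exact HL|exact Cg| |].
      + apply (continuity_scal (fun x => x ^ (2 * (d + m)))), pow_continuity.
      + intros x.
        assert (P9 : 0 < (/ 9) ^ m) by (apply pow_lt; lra).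
        rewrite pow_mult; rewrite <- Sq, <- pow_mult.
        destruct (Rle_dec (Rabs x) 3) as [Q|Q].
        * apply Rle_trans with 0; [now apply H1|].
          apply Rmult_le_pos; [apply Rmult_le_pos; lra|apply pow_le, Rabs_pos].
        * eapply Rle_trans; [apply H2; lra|].
          rewrite Nat.mul_add_distr_l, pow_add, (pow_mult _ 2 m).
          assert (R9 : 9 ^ m <= (Rabs x ^ 2) ^ m) by (apply pow_incr; simpl; nra).
          assert (1 <= (/ 9) ^ m * (Rabs x ^ 2) ^ m).
          { replace 1 with ((/ 9) ^ m * 9 ^ m).
            - apply Rmult_le_compat_l; lra.
            - rewrite <- Rpow_mult_distr, Rinv_l, pow1; lra. }
          assert (0 <= C * Rabs x ^ (2 * d))
            by (apply Rmult_le_pos; [exact HC|apply pow_le, Rabs_pos]).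
          replace (C * (/ 9) ^ m * (Rabs x ^ (2 * d) * (Rabs x ^ 2) ^ m))
            with (C * Rabs x ^ (2 * d) * ((/ 9) ^ m * (Rabs x ^ 2) ^ m)) by ring.
          rewrite <- (Rmult_1_r (C * Rabs x ^ (2 * d))) at 1.
          now apply Rmult_le_compat_l.
    - destruct HL as (_ & Lscal & _ & Hm).
      rewrite Lscal by apply pow_continuity; rewrite Hm.
      pose proof (jac_pow_bound (2 * (d + m)) 1) as J.
      pose proof (Rle_abs (jac_pow_delta1 (2 * (d + m)) 1)).
      unfold jac_moment.
      assert (P9 : 0 < (/ 9) ^ m) by (apply pow_lt; lra).
      apply Rle_trans with (C * (/ 9) ^ m * 2 ^ (2 * (d + m))).
      + apply Rmult_le_compat_l; [apply Rmult_le_pos; lra|lra].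
      + apply Req_le; rewrite pow_mult; replace (2 ^ 2) with 4 by ring.
        unfold Rdiv; rewrite Rpow_mult_distr, pow_add; ring. }
  apply Rnot_lt_le; intros Lt.
  assert (P4 : 0 < 4 ^ d) by (apply pow_lt; lra).
  assert (HC0 : 0 <= C * 4 ^ d) by (apply Rmult_le_pos; lra).
  (* Adding 1 keeps the divisor positive when [C = 0]. *)
  destruct (pow_lt_1_zero (4 / 9)) with (y := L g / (C * 4 ^ d + 1)) as [N HN].
  - rewrite Rabs_right; lra.
  - apply Rdiv_lt_0_compat; lra.
  - specialize (HN N (le_n N)); specialize (B N).
    assert (0 < (4 / 9) ^ N) by (apply pow_lt; lra).
    rewrite Rabs_right in HN by lra.
    apply (Rmult_lt_compat_l (C * 4 ^ d + 1)) in HN; [|lra].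
    replace ((C * 4 ^ d + 1) * (L g / (C * 4 ^ d + 1))) with (L g) in HN by (field; lra).
    lra.
Qed.

(* Bounded, but at least [(x - x0)^2 / 26] when [|x| <= 3] and [|x0| <= 2]. *)
Definition bump (x0 x : R) : R := (x - x0) ^ 2 / (1 + (x - x0) ^ 2).

Lemma bump_denominator (x0 x : R) : 0 < 1 + (x - x0) ^ 2.
Proof. pose proof (pow2_ge_0 (x - x0)); lra. Qed.

Lemma sq_shift_continuity (x0 : R) : continuity (fun x => (x - x0) ^ 2).
Proof.
  apply (continuity_comp (fun x => x - x0) (fun x => x ^ 2)); [|apply pow_continuity].
  apply (continuity_minus (fun x => x) (fun _ => x0)).
  - apply derivable_continuous, derivable_id.
  - now apply continuity_const.
Qed.

Lemma bump_continuity (x0 : R) : continuity (bump x0).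
Proof.
  apply (continuity_div (fun x => (x - x0) ^ 2) (fun x => 1 + (x - x0) ^ 2)).
  - apply sq_shift_continuity.
  - apply (continuity_plus (fun _ => 1) (fun x => (x - x0) ^ 2));
      [now apply continuity_const|apply sq_shift_continuity].
  - intros x; pose proof (bump_denominator x0 x); lra.
Qed.

Lemma K_polyfun (n : nat) (y : R) : polyfun n (fun x => ex41_K n x y).
Proof.
  induction n as [|n IH].
  - exists (ex41_p 0 y); intros x; unfold ex41_K; simpl; rewrite p_0; ring.
  - rewrite (functional_extensionality _
      (fun x => 1 * ex41_K n x y + ex41_p (S n) y * ex41_p (S n) x))
      by (intros x; rewrite K_S; ring).
    apply polyfun_lin; [now apply polyfun_weaken|apply p_polyfun].
Qed.

(** By the Christoffel-Darboux formula [q] is a combination of two orthonormal polynomials, with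
    squared norm $a_{n+1}^2 (p_n^2 + p_{n+1}^2)$ at $x_0$. The constant is [104 = 26 * 4]: 26 from
    the bump, 4 from [a >= 1/2]. *)
Lemma L_bump_lower_bound (L : (R -> R) -> R) (n : nat) (x0 : R) :
  is_spectral_integral L -> Rabs x0 <= 2 ->
  ex41_p n x0 ^ 2 + ex41_p (S n) x0 ^ 2 <=
  104 * L (fun x => bump x0 x * ex41_K n x x0 ^ 2).
Proof.
  intros HL Hx0.
  set (a := ex41_a (S n)).
  set (q := fun x => a * ex41_p n x0 * ex41_p (S n) x + - (a * ex41_p (S n) x0) * ex41_p n x).
  assert (qE : forall x, q x = (x - x0) * ex41_K n x x0)
    by (intros x; rewrite christoffel_darboux; unfold q, a; ring).
  assert (Pq : polyfun (S n) q).
  { apply polyfun_lin; [apply p_polyfun|apply polyfun_weaken, p_polyfun]. }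
  assert (Cq : continuity (fun x => q x ^ 2)).
  { apply (continuity_comp q (fun x => x ^ 2)); [now apply (polyfun_continuous (S n))|].
    apply pow_continuity. }
  assert (Cb : continuity (fun x => bump x0 x * ex41_K n x x0 ^ 2)).
  { apply (continuity_mult (bump x0) (fun x => ex41_K n x x0 ^ 2)); [apply bump_continuity|].
    apply (continuity_comp (fun x => ex41_K n x x0) (fun x => x ^ 2));
      [apply (polyfun_continuous n), K_polyfun|apply pow_continuity]. }
  destruct (polyfun_growth (S n) q Pq) as (C & C0 & HC).
  (* The comparison of [q^2 / 26] with the bump integrand holds only for [|x| <= 3]; beyond that,
     polynomial growth suffices for [L_nonpos]. *)
  assert (E : L (fun x => / 26 * q x ^ 2 + -1 * (bump x0 x * ex41_K n x x0 ^ 2)) <= 0).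
  { assert (gE : forall x, / 26 * q x ^ 2 + -1 * (bump x0 x * ex41_K n x x0 ^ 2) =
       q x ^ 2 * (/ 26 - / (1 + (x - x0) ^ 2))).
    { intros x; pose proof (bump_denominator x0 x); rewrite qE; unfold bump; field; lra. }
    apply (L_nonpos L _ (C ^ 2) (S n)); [exact HL| |apply pow2_ge_0| |].
    - apply (continuity_plus (fun x => / 26 * q x ^ 2)
        (fun x => -1 * (bump x0 x * ex41_K n x x0 ^ 2))).
      + now apply (continuity_scal (fun x => q x ^ 2)).
      + now apply (continuity_scal (fun x => bump x0 x * ex41_K n x x0 ^ 2)).
    - intros x Hx; rewrite gE.
      assert (/ 26 <= / (1 + (x - x0) ^ 2)).
      { apply Rinv_le_contravar; [apply bump_denominator|].
        pose proof (Rabs_triang x (- x0)) as T; rewrite Rabs_Ropp in T.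
        assert ((x - x0) ^ 2 <= 5 ^ 2); [|lra].
        rewrite <- pow2_abs; apply pow_incr; split; [apply Rabs_pos|unfold Rminus; lra]. }
      pose proof (pow2_ge_0 (q x)); nra.
    - intros x Hx; rewrite gE.
      assert (0 < / (1 + (x - x0) ^ 2)) by (apply Rinv_0_lt_compat, bump_denominator).
      pose proof (pow2_ge_0 (q x)).
      apply Rle_trans with (q x ^ 2); [nra|].
      rewrite <- pow2_abs, Nat.mul_comm, pow_mult, <- Rpow_mult_distr.
      apply pow_incr; split; [apply Rabs_pos|apply HC; lra]. }
  rewrite L_lin in E by auto.
  unfold q in E; rewrite L_square in E by exact HL.
  assert (a2 : / 4 <= a * a) by (pose proof (a_bounds (S n)); unfold a; nra).
  pose proof (pow2_ge_0 (ex41_p n x0)); pose proof (pow2_ge_0 (ex41_p (S n) x0)).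
  replace ((a * ex41_p n x0) ^ 2 + (- (a * ex41_p (S n) x0)) ^ 2)
    with (a * a * (ex41_p n x0 ^ 2 + ex41_p (S n) x0 ^ 2)) in E by ring.
  assert (/ 4 * (ex41_p n x0 ^ 2 + ex41_p (S n) x0 ^ 2) <=
          a * a * (ex41_p n x0 ^ 2 + ex41_p (S n) x0 ^ 2))
    by (apply Rmult_le_compat_r; lra).
  lra.
Qed.

(** The test function [bump x] vanishes at [x], so its averages tend to 0; the threshold
    [(|x| - 1) / 104] absorbs the constant of the lower bound. *)
Lemma nevai_slow_growth (L : (R -> R) -> R) (x : R) :
  is_spectral_integral L -> 1 < Rabs x <= 2 -> nevai_at L x ->
  exists i, slow_growth i x.
Proof.
  intros HL Hx HN.
  assert (Hb : exists M, forall y, Rabs (bump x y) <= M).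
  { exists 1; intros y; pose proof (bump_denominator x y); pose proof (pow2_ge_0 (y - x)).
    rewrite Rabs_right.
    - unfold bump; apply (Rmult_le_reg_r (1 + (y - x) ^ 2)); [lra|].
      unfold Rdiv; rewrite Rmult_assoc, Rinv_l; lra.
    - apply Rle_ge, Rmult_le_pos; [lra|now apply Rlt_le, Rinv_0_lt_compat]. }
  destruct (HN (bump x) (bump_continuity x) Hb ((Rabs x - 1) / 104) ltac:(lra)) as [N H].
  destruct (archimed_cor1 (Rabs x - 1) ltac:(lra)) as (k & Hk & k0).
  (* [k] places [|x|] far enough from 1, and [N] is where the averages become small. *)
  exists (N + k)%nat; split.
  - assert (/ (INR (N + k) + 1) <= / INR k); [|lra].
    apply Rinv_le_contravar; [now apply lt_0_INR|].
    rewrite plus_INR; pose proof (pos_INR N); lra.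
  - intros n Hn; specialize (H n ltac:(lia)).
    unfold Rdist in H.
    replace (bump x x) with 0 in H by (unfold bump; rewrite Rminus_diag; simpl; lra).
    rewrite Rminus_0_r in H.
    pose proof (Rle_abs (L (fun y => bump x y * ex41_K n y x ^ 2) / ex41_K n x x)).
    pose proof (K_ge_1 n x) as K1.
    pose proof (L_bump_lower_bound L n x HL (proj2 Hx)) as B.
    set (v := L (fun y => bump x y * ex41_K n y x ^ 2)) in *.
    assert (v / ex41_K n x x * ex41_K n x x <= (Rabs x - 1) / 104 * ex41_K n x x)
      by (apply Rmult_le_compat_r; lra).
    replace (v / ex41_K n x x * ex41_K n x x) with v in * by (field; lra).
    lra.
Qed.

Theorem theorem4p2 :
  forall L : (R -> R) -> R,
    is_spectral_integral L ->
    lebesgue_null (fun x0 => (1 < Rabs x0 <= 2) /\ nevai_at L x0).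
Proof.
  intros L HL e He.
  destruct (null_union slow_growth slow_growth_cover e He) as (a & b & H1 & H2 & H3).
  exists a, b; repeat split; [exact H1| |exact H3].
  intros x [Hx HN]; apply H2; now apply (nevai_slow_growth L).
Qed.
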